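(* Let $C\ge c/(1-\beta)$, where $c$ and $\beta$ are the constants in the distortion condition (JF) for the tower map $F$. For each integer $n\ge1$ let $\varphi_n$ be the unique element of $\mathcal C_n$ with $\mathcal P_n\varphi_n=\lambda_n\varphi_n$, $\lambda_n=\|\mathcal P_n\varphi_n\|_{L^1(\Delta,\nu)}$, and let $\mu_n$ be the measure on $\Delta$ with density $d\mu_n/d\nu=\varphi_n$. Then $\mu_n$ is an absolutely continuous conditionally invariant probability measure for the open system with hole $H_n$ (that is, $\mu_n(F^{-1}(E)\setminus H_n)=\lambda_n\,\mu_n(E)$ for every measurable $E\subseteq\Delta\setminus H_n$). In particular, $\lambda_n=1-\mu_n(H_n^1)$.
   Context: MAP. Let $\alpha\in(0,1)$ and let $T:[0,1]\to[0,1]$ be a Pomeau--Manneville map: near $0$, $T(x)=x+c_\alpha x^{1+\alpha}+g(x)$ with $c_\alpha>0$, $g$ of class $C^2$ and $g'(x)=o(x^\alpha)$ as $x\to0$; there is $x_0\in(0,1)$ such that $T$ is one-to-one and onto $(0,1)$ on each of $(0,x_0)$ and $(x_0,1)$; $T$ is $C^2$ on $(x_0,1)$ and on $(\epsilon,x_0)$ for every $\epsilon>0$; and $T'>1$ on $(0,x_0)$ and on $(x_0,1)$. TOWER. Put $\Delta_0=[x_0,1]$, $R(x)=\min\{k>0: T^k(x)\in(x_0,1)\}$ (first return time, defined a.e.), $\Delta_{0,i}=\{x\in\Delta_0: R(x)=i\}$ for $i\ge1$, $\Delta=\{(x,\ell): x\in\Delta_0,\ \ell\in\{0,1,2,\dots\},\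 \ell<R(x)\}$, cells $\Delta_{\ell,i}=\Delta_{0,i}\times\{\ell\}$ ($0\le\ell<i$), levels $\Delta_\ell=\bigcup_{i>\ell}\Delta_{\ell,i}$; the base $\Delta_0$ is identified with $\Delta_0\times\{0\}$. The tower map $F:\Delta\to\Delta$ is $F(x,\ell)=(x,\ell+1)$ if $\ell<R(x)-1$ and $F(x,R(x)-1)=(T^{R(x)}(x),0)$; each top cell $\Delta_{i-1,i}$ is mapped injectively onto $\Delta_0$ (mod null sets). The measure $\nu$ on $\Delta$ is Lebesgue measure on $\Delta_0$ lifted by upwards translation; it is finite. $JF=d(\nu\circ F)/d\nu$ is the Jacobian. The separation time $s(x,y)$ counts the number of returns to $\Delta_0$ before the orbits of $x$ and $y$ are in different elements of $\{\Delta_{0,i}\}$: for $x,y\in\Delta_0$, $s(x,y)$ is the least $k\ge0$ such that the $k$-th returns to $\Delta_0$ of $x$ and $y$ lie in different $\Delta_{0,i}$, and for $(x,\ell),(y,\ell)$ in the same cell, $s((x,\ell),(y,\ell))=s(x,y)$. It is assumed that $F$ is non-singular and satisfies, for constants $\beta\in(0,1)$ and $c<\infty$, (JF) $\left|\frac{JF(x)}{JF(y)}\right|\le e^{c\,\beta^{s(F(x),F(y))}}$ for $x,y$ in the same cell $\Delta_{\ell,i}$. HOLE AND OPERATORS. For an integer $n\ge1$ let $H_n=\bigcup_{i\ge n+1}\bigcup_{1\le\ell<i}\Delta_{\ell,i}$ be the hole and $H_n^1=\bigcup_{i\ge n+1}\Delta_{0,i}$ (the points outside $H_n$ that fall into $H_n$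 in exactly one iteration of $F$). The Perron--Frobenius operator is $\mathcal P\varphi(x)=\sum_{y\in F^{-1}x}\varphi(y)/|JF(y)|$ on $L^1(\Delta,\nu)$, and the conditional operator is $\mathcal P_n\varphi=\chi_{\Delta\setminus H_n}\,\mathcal P(\varphi\,\chi_{\Delta\setminus H_n})$. CONES. Two points are comparable if both lie in the same cell $\Delta_{\ell,i}$ or both lie in $\Delta_0$. For a fixed $C>0$, $\mathcal C_*=\{\varphi\in L^1(\Delta,\nu): \varphi\ge0,\ \varphi(x)\le\varphi(y)e^{C\beta^{s(x,y)}}\text{ for a.e. comparable }x,y\}$ and $\mathcal C_n=\{\varphi\in\mathcal C_*: \int_{\Delta\setminus H_n}\varphi\,d\nu=1,\ \varphi|_{H_n}=0\}$. For $C\ge c/(1-\beta)$ an element $\varphi_n\in\mathcal C_n$ with $\mathcal P_n\varphi_n=\lambda_n\varphi_n$, $\lambda_n=\|\mathcal P_n\varphi_n\|_{L^1}$, exists and is unique in $\mathcal C_n$. *)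

(* Defs.v *)
From HB Require Import structures.
From mathcomp Require Import all_boot all_order all_algebra.
From mathcomp Require Import all_classical all_reals all_analysis.
From mathcomp Require Import measurable_realfun.

Set Implicit Arguments.
Unset Strict Implicit.
Unset Printing Implicit Defensive.
Import Order.TTheory GRing.Theory Num.Theory.
Import numFieldNormedType.Exports.

Local Open Scope classical_set_scope.
Local Open Scope ring_scope.

(* The library only declares counting as a sigma-finite content. *)
HB.instance Definition _ (R : realType) :=
  Measure_isSigmaFinite.Build _ nat R (@counting nat R)
    (sigma_finite_counting R).

(* None stands for an infinite minimum (no element of P). *)
Definition least (P : set nat) : option nat :=
  xget None [set Some k | k in [set k | P k /\ forall j, P j -> (k <= j)%N]].

(* Meant for open D: the derivatives are two-sided. *)
Definition C2_on (R : realType) (f : R -> R) (D : set R) : Prop :=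
  forall x, D x ->
    [/\ derivable f x 1, derivable (f^`())%classic x 1
      & {for x, continuous (f^`(2))%classic}].

(* The values of the map outside [0,1] are irrelevant.  The class C^2 of the
   remainder g is only required on ]0,d[ (with g continuous at 0): this is the
   weakest reading, and the only one under which g'(x) = o(x^alpha) says more
   than g'(0) = 0. *)
Record pm_map (R : realType) (alpha : R) := PMMap {
  pm_fun :> R -> R ;
  pm_x0 : R ;
  pm_x0_gt0 : 0 < pm_x0 ;
  pm_x0_lt1 : pm_x0 < 1 ;
  pm_fun01 : set_fun `[0, 1] `[0, 1] pm_fun ;
  pm_near0 : exists (c : R) (g : R -> R) (d : R),
    [/\ 0 < c, 0 < d,
        forall x : R, x \in `[0, d[ -> pm_fun x = x + c * x `^ (1 + alpha) + g x,
        C2_on g `]0, d[ & g x @[x --> 0^'+] --> g 0] /\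
    (g^`())%classic =o_ (0^'+) (fun x : R => x `^ alpha) ;
  pm_bij_left : set_bij `]0, pm_x0[ `]0, 1[ pm_fun ;
  pm_bij_right : set_bij `]pm_x0, 1[ `]0, 1[ pm_fun ;
  pm_C2_left : forall e : R, 0 < e -> C2_on pm_fun `]e, pm_x0[ ;
  pm_C2_right : C2_on pm_fun `]pm_x0, 1[ ;
  pm_expand_left : forall x : R, x \in `]0, pm_x0[ -> 1 < (pm_fun^`())%classic x ;
  pm_expand_right : forall x : R, x \in `]pm_x0, 1[ -> 1 < (pm_fun^`())%classic x
}.

(* Ambient space of the tower: a point (x, l) stands for x at level l. *)
Notation tower_space R := (measurableTypeR R * nat)%type.

Section tower.
Context (R : realType) (alpha : R) (T : pm_map alpha).
Local Notation x0 := (pm_x0 T).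
Implicit Types (x y : R) (z w : tower_space R) (k l i n : nat).

(* Time 0 encodes that x never returns. *)
Definition return_time x : nat :=
  odflt 0%N (least [set k | (0 < k)%N /\ iter k T x \in `]x0, 1[]).

Definition base_cell i : set R :=
  [set x | x \in `[x0, 1] /\ return_time x = i].

Definition tower : set (tower_space R) :=
  [set z | z.1 \in `[x0, 1] /\ (z.2 < return_time z.1)%N].

Definition cell l i : set (tower_space R) :=
  [set z | base_cell i z.1 /\ z.2 = l /\ (l < i)%N].

Definition base_return x : R := iter (return_time x) T x.

Definition tower_map z : tower_space R :=
  if (z.2.+1 < return_time z.1)%N then (z.1, z.2.+1) else (base_return z.1, 0%N).

(* F^-1(E), as a subset of the tower *)
Definition tower_preimage (E : set (tower_space R)) : set (tower_space R) :=
  tower `&` tower_map @^-1` E.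

(* A point that does not return lies in no base cell, hence counts as separated
   from every point; this only concerns a null set. *)
Definition separated_at x y k : Prop :=
  ~ exists i, [/\ (0 < i)%N, base_cell i (iter k base_return x)
                & base_cell i (iter k base_return y)].

Definition separation_time z w : option nat := least (separated_at z.1 w.1).

Definition sep_pow (beta : R) z w : R :=
  if separation_time z w is Some k then beta ^+ k else 0.

Definition tower_comparable z w : Prop :=
  (exists l i, cell l i z /\ cell l i w) \/
  [/\ tower z, tower w, z.2 = 0%N & w.2 = 0%N].

(* The tower is measurable, so that the ambient measure restricts to it. *)

Lemma iter_pm01 k x : x \in `[0, 1] -> iter k T x \in `[0, 1].
Proof. by move=> x01; elim: k => //= k; exact: (@pm_fun01 _ _ T (iter k T x)). Qed.

Lemma base_sub01 x : x \in `[x0, 1] -> x \in `[0, 1].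
Proof.
rewrite !in_itv/= => /andP[x0x ->]; rewrite andbT.
exact: le_trans (ltW (pm_x0_gt0 T)) x0x.
Qed.

Lemma measurable_pm : measurable_fun (`[0, 1]%classic : set (measurableTypeR R))
  (T : measurableTypeR R -> measurableTypeR R).
Proof.
have oc (a b : R) : (forall x : R, x \in `]a, b[ -> derivable T x 1) ->
    measurable_fun (`]a, b[%classic : set (measurableTypeR R))
      (T : measurableTypeR R -> measurableTypeR R).
  move=> dT; apply: open_continuous_measurable_fun; first exact: interval_open.
  move=> x /[!inE] xab; apply: differentiable_continuous.
  exact/derivable1_diffP/dT.
have pt (a : R) : measurable_fun ([set a] : set (measurableTypeR R))
    (T : measurableTypeR R -> measurableTypeR R) by exact: measurable_fun_set1.
have -> : (`[0, 1]%classic : set (measurableTypeR R)) =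
    [set 0] `|` `]0, x0[%classic `|` [set x0] `|` `]x0, 1[%classic `|` [set 1].
  have := pm_x0_gt0 T; have := pm_x0_lt1 T => x01 x00.
  apply/seteqP; split => x /=; rewrite !in_itv/=.
    move=> /andP[]; rewrite !le_eqVlt => /orP[/eqP <-|x_gt0]; first by tauto.
    move=> /orP[/eqP ->|x_lt1]; first by tauto.
    case: (ltgtP x x0) => [xl|xg|->].
    - by do 3 left; right; rewrite x_gt0.
    - by left; right; rewrite x_lt1.
    - by left; left; right.
  move=> [[[[->|/andP[a b]]|->]|/andP[a b]]|->].
  - by rewrite lexx ler01.
  - by rewrite (ltW a) (ltW (lt_trans b x01)).
  - by rewrite (ltW x00) (ltW x01).
  - by rewrite (ltW b) (ltW (lt_trans x00 a)).
  - by rewrite lexx ler01.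
have dl x : x \in `]0, x0[ -> derivable T x 1.
  rewrite in_itv/= => /andP[x_gt0 xx0].
  have [] // := @pm_C2_left _ _ T (x / 2) _ x; first by rewrite divr_gt0.
  by rewrite /= in_itv/= xx0 andbT ltr_pdivrMr// ltr_pMr// ltr1n.
have dr x : x \in `]x0, 1[ -> derivable T x 1.
  by move=> xx0; have [] := @pm_C2_right _ _ T x xx0.
apply/measurable_funU; [by repeat apply: measurableU|by []|split; last exact: pt].
apply/measurable_funU; [by repeat apply: measurableU|by []|split; last exact: oc].
apply/measurable_funU; [by repeat apply: measurableU|by []|split; last exact: pt].
apply/measurable_funU; [by []|by []|split; last exact: oc].
exact: pt.
Qed.

Lemma measurable_iter_pm k :
  measurable_fun (`[x0, 1]%classic : set (measurableTypeR R))
    (iter k T : measurableTypeR R -> measurableTypeR R).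
Proof.
elim: k => [|k IH]; first exact: measurable_id.
apply: (measurable_comp _ _ measurable_pm IH) => //.
by move=> _ [x /= xB <-]; apply/iter_pm01/base_sub01.
Qed.

Lemma least_spec (P : set nat) :
  match least P with
  | Some k => P k /\ forall j, P j -> (k <= j)%N
  | None => forall k, ~ P k
  end.
Proof.
rewrite /least; case: xgetP => [_ -> [k [Pk kP] <-]//|none k Pk].
have exP : exists k, `[< P k >] by exists k; apply/asboolP.
case: (ex_minnP exP) => m /asboolP Pm mP.
by apply: (none (Some m)); exists m => //; split=> // j /asboolP; exact: mP.
Qed.

Lemma lt_return_time l x : (l < return_time x)%N <->
  (exists2 k, (0 < k)%N & iter k T x \in `]x0, 1[) /\
  forall j, (0 < j <= l)%N -> iter j T x \notin `]x0, 1[.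
Proof.
rewrite /return_time; have := least_spec
  [set k | (0 < k)%N /\ iter k T x \in `]x0, 1[].
case: least => [k /= [[k0 kx] kmin]|none]; last first.
  by split=> //= -[[k k0 kx] _]; exfalso; apply: (none k).
split=> [lk|[_ lj]].
  split; first by exists k.
  move=> j /andP[j0 jl]; apply/negP => jx.
  by have := kmin j (conj j0 jx); rewrite leqNgt (leq_ltn_trans jl lk).
by rewrite ltnNge; apply/negP => kl; have := lj k; rewrite k0 kl kx => /(_ isT).
Qed.

Lemma measurable_tower : measurable tower.
Proof.
pose B k : set (measurableTypeR R) :=
  `[x0, 1]%classic `&`
    (iter k T : _ -> measurableTypeR R) @^-1` `]x0, 1[%classic.
have mB k : measurable (B k) by exact: measurable_iter_pm.
pose A l : set (measurableTypeR R) :=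
  \bigcup_(k in [set k | (0 < k)%N]) B k `\`
  \bigcup_(j in [set j | (0 < j <= l)%N]) B j.
have -> : tower = \bigcup_l (A l `*` [set l]).
  apply/seteqP; split => [[x l] [/= xB /lt_return_time[[k k0 kx] lj]]|[x l]].
    exists l => //; split=> //=; split; first by exists k.
    by move=> [j /= jl [_ /= jx]]; move: (lj _ jl); rewrite jx.
  move=> [m _] [/= [[k /= k0 [/= xB kx]] nB] ->]; split=> //=.
  apply/lt_return_time; split; first by exists k.
  by move=> j jl; apply/negP => jx; apply: nB; exists j.
apply: bigcupT_measurable => l; apply: measurableX => //.
by apply: measurableD; apply: bigcup_measurable.
Qed.

(* Lebesgue measure on every level: Lebesgue times counting, on the tower *)
Definition tower_measure : set (tower_space R) -> \bar R :=
  mrestr (lebesgue_measure \x @counting nat R)%E measurable_tower.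
HB.instance Definition _ := Measure.on tower_measure.
Local Notation nu := tower_measure.

Definition nonsingular : Prop := forall E : set (tower_space R),
  measurable E -> nu E = 0%E -> nu (tower_preimage E) = 0%E.

(* JF is a version of d(nu o F)/dnu: F is only injective cell by cell, so
   nu o F is the measure E |-> nu (F(E)) on each cell. *)
Definition tower_jacobian (JF : tower_space R -> R) : Prop :=
  [/\ measurable_fun tower JF,
      forall z, tower z -> JF z != 0
    & forall l i (E : set (tower_space R)), (l < i)%N ->
        measurable E -> E `<=` cell l i ->
        (nu (tower_map @` E) = \int[nu]_(z in E) (JF z)%:E)%E].

Definition distortion (JF : tower_space R -> R) (c beta : R) : Prop :=
  forall l i z w, cell l i z -> cell l i w ->
    `|JF z / JF w| <= expR (c * sep_pow beta (tower_map z) (tower_map w)).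

Definition hole n : set (tower_space R) :=
  \bigcup_(i in [set i | (n < i)%N])
    \bigcup_(l in [set l | (0 < l < i)%N]) cell l i.

Definition hole1 n : set (tower_space R) :=
  \bigcup_(i in [set i | (n < i)%N]) cell 0 i.

(* The sum over F^-1(z) of a signed family, as the difference of the sums of its
   positive and negative parts. *)
Definition transfer (JF phi : tower_space R -> R) z : \bar R :=
  let f w := (phi w / `|JF w|)%:E in
  (esum (tower_preimage [set z]) f^\+ - esum (tower_preimage [set z]) f^\-)%E.

Definition cond_transfer (JF : tower_space R -> R) n
    (phi : tower_space R -> R) z : \bar R :=
  ((\1_(tower `\` hole n) z)%:E *
   transfer JF (fun w => phi w * \1_(tower `\` hole n) w)%R z)%E.

Definition cone (C beta : R) : set (tower_space R -> R) :=
  [set phi | [/\ nu.-integrable setT (EFin \o phi),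
     \forall z \ae nu, 0 <= phi z
   & \forall z \ae nu, \forall w \ae nu, tower_comparable z w ->
       phi z <= phi w * expR (C * sep_pow beta z w)]].

Definition cone_hole (C beta : R) n : set (tower_space R -> R) :=
  [set phi | [/\ cone C beta phi,
     (\int[nu]_(z in tower `\` hole n) (phi z)%:E = 1)%E
   & \forall z \ae nu, hole n z -> phi z = 0]].

(* mu is an absolutely continuous conditionally invariant probability measure
   for the open system with hole H, with eigenvalue lam. *)
Definition accim (H : set (tower_space R))
    (mu : {measure set (tower_space R) -> \bar R}) (lam : \bar R) : Prop :=
  [/\ mu setT = 1%E, mu `<< nu
    & forall E, measurable E -> E `<=` tower `\` H ->
        mu (tower_preimage E `\` H) = (lam * mu E)%E].

End tower.

(* Main.v *)
Require Import Defs.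
From HB Require Import structures.
From mathcomp Require Import all_boot all_order all_algebra.
From mathcomp Require Import all_classical all_reals all_analysis.
From mathcomp Require Import measurable_realfun.

(** The Perron-Frobenius operator P of the tower map F is dual to composition
with F: the integral of P psi over E is the integral of psi over F^-1(E).  Take
psi = phi on the complement of the hole H and psi = 0 on H.  For E outside H the
right-hand side is mu(F^-1(E) \ H), while P psi = lambda phi almost everywhere
on E, so that the left-hand side is lambda mu(E): this is conditional invariance
([conditional_invariance]).  For E the whole complement of H, mu(E) = 1, so
lambda is the mass that stays outside H after one step; up to a null set, the
mass that does not stay sits on the points which F maps into H, and those form
H^1 ([hole_tower_map]).

All the work is in the duality ([transfer_duality]).  On one cell it is the
change of variables given by the Jacobian ([ge0_integral_branch]), and the
cells are then summed ([integral_fibre_sum]).  The change of variables needs an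
inverse of F on each cell that is measurable and has a measurable image.  On a
cell below the top F shifts the level.  On the top cell of return time i, F is
the i-th iterate of T: one passage through the right branch followed by i - 1
passages through the left one.  Both branches are strictly increasing bijections
onto (0, 1), so their inverses are monotone, hence measurable, and the inverse
of the i-th return is R o L^(i-1), with L and R the inverses of the left and
right branches ([return_inverseP], [return_inverseK]).  The formula fails only
for orbits that meet an endpoint of a branch; their starting points form a
countable set, and neither that set nor its forward orbit, taken at all levels
of the tower, carries any mass. *)

Set Implicit Arguments.
Unset Strict Implicit.
Unset Printing Implicit Defensive.
Import Order.TTheory GRing.Theory Num.Theory.
Import numFieldNormedType.Exports.

Local Open Scope classical_set_scope.
Local Open Scope ring_scope.

(** * Integration against a density *)

Section density.
Context d (X : measurableType d) (R : realType).
Variables (m1 m2 : {measure set X -> \bar R}) (A : set X) (J : X -> R).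
Hypotheses (mA : measurable A) (mJ : measurable_fun A J).
Hypothesis J_ge0 : forall x, A x -> 0 <= J x.
Hypothesis m1E : forall E, measurable E -> E `<=` A ->
  m1 E = (\int[m2]_(x in E) (J x)%:E)%E.

Import HBNNSimple.
Local Open Scope ereal_scope.

(** The hypothesis is the formula for f the indicator of a set E; both sides are
linear in f and continuous along increasing sequences, so simple functions
carry it to every f. *)
Lemma ge0_integral_density (f : X -> \bar R) :
  measurable_fun A f -> (forall x, A x -> 0 <= f x) ->
  \int[m1]_(x in A) f x = \int[m2]_(x in A) (f x * (J x)%:E).
Proof.
move=> mf f0; have mJ' : measurable_fun A (EFin \o J) by exact/measurable_EFinP.
pose h := nnsfun_approx mA mf.
have fE x : A x -> f x = lim ((EFin \o h n) x @[n --> \oo]).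
  by move=> Ax; apply/esym/cvg_lim => //; exact: cvg_nnsfun_approx.
have cvgh x : A x -> (EFin \o h n) x @[n --> \oo] --> f x.
  by move=> Ax; exact: cvg_nnsfun_approx.
have ndh x m n : (m <= n)%N -> (h m x <= h n x)%R.
  by move=> mn; exact/lefP/nd_nnsfun_approx.
transitivity (lim (\int[m1]_(x in A) (EFin \o h n) x @[n --> \oo])).
  under eq_integral => x /[!inE] /fE -> //.
  apply: monotone_convergence => //.
  - by move=> n; apply/measurable_EFinP/measurable_funTS.
  - by move=> n x Ax /=; rewrite lee_fin.
  - by move=> x Ax a b ab; rewrite lee_fin; exact: ndh.
have fJE x : A x ->
    f x * (J x)%:E = lim ((EFin \o h n) x * (J x)%:E @[n --> \oo]).
  move=> Ax; apply/esym/cvg_lim => //.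
  by apply: cvgeZr => //; exact: cvgh.
transitivity
    (lim (\int[m2]_(x in A) ((EFin \o h n) x * (J x)%:E) @[n --> \oo])).
  congr (lim (_ @ \oo)); apply/funext => n.
  transitivity (\int[m1]_(x in A)
      (\sum_(y \in range (h n)) (y * \1_(h n @^-1` [set y]) x)%:E)).
    by apply: eq_integral => t tE; rewrite /= fimfunE -fsumEFin.
  have indich r : measurable_fun A (fun x => (r * \1_(h n @^-1` [set r]) x)%:E).
    by apply: (measurable_comp measurableT) => //; exact: measurable_funM.
  rewrite ge0_integral_fsum//; last by move=> m y Ey; exact: nnfun_muleindic_ge0.
  transitivity (\int[m2]_(x in A) (\sum_(y \in range (h n))
      (y * \1_(h n @^-1` [set y]) x)%:E * (J x)%:E)); last first.
    apply: eq_integral => x xE.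
    rewrite -ge0_mule_fsuml => [|y]; last exact: nnfun_muleindic_ge0.
    by rewrite fsumEFin // -(fimfunE _ x).
  rewrite ge0_integral_fsum//; last 2 first.
  - by move=> y; apply: emeasurable_funM.
  - by move=> m y Ey; rewrite mule_ge0 ?nnfun_muleindic_ge0 ?lee_fin ?J_ge0.
  apply: eq_fsbigr => r rhn.
  rewrite integralZl_indic_nnsfun => //.
  under [RHS]eq_integral do rewrite EFinM -muleA.
  rewrite ge0_integralZl//.
  - under [X in _ = _ * X]eq_integral do rewrite muleC.
    rewrite [X in _ = _ * X](eq_integral ((EFin \o J) \_ (h n @^-1` [set r]))); last first.
      by move=> x xE; rewrite epatch_indic.
    rewrite -integral_mkcondr -m1E//.
    by rewrite integral_indic// setIC.
  - by apply: emeasurable_funM => //; exact/measurable_EFinP.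
  - by move=> t Et; rewrite mule_ge0 ?lee_fin ?J_ge0.
  - by move: rhn; rewrite inE => -[t _ <-]; rewrite lee_fin.
under [RHS]eq_integral => x /[!inE] /fJE -> //.
apply/esym/monotone_convergence => //.
- move=> n; apply: emeasurable_funM => //.
  by apply/measurable_EFinP/measurable_funTS.
- by move=> n x Ax /=; rewrite mule_ge0 ?lee_fin ?J_ge0.
- by move=> x Ax a b ab; rewrite lee_wpmul2r ?lee_fin ?J_ge0 ?ndh.
Qed.
End density.

(** * Change of variables on an injective branch *)

Lemma measurable_fun_normV d (X : measurableType d) (R : realType) (A : set X)
    (J : X -> R) :
  measurable_fun A J -> measurable_fun A (fun x => `|J x|^-1).
Proof.
move=> mJ; apply: (eq_measurable_fun (fun x => `|J x| `^ (-1))).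
  by move=> x _; rewrite powR_inv1.
by apply: (measurableT_comp (measurable_powR (-1))); exact: measurableT_comp.
Qed.

Section branch.
Context d (X : measurableType d) (R : realType).
Variables (nu : {measure set X -> \bar R}) (A : set X) (f S : X -> X).
Variable J : X -> R.
Hypotheses (mA : measurable A) (mfA : measurable (f @` A)).
Hypotheses (mS : measurable_fun setT S) (fK : {in A, cancel f S}).
Hypotheses (mJ : measurable_fun A J) (J_neq0 : forall x, A x -> J x != 0).
Hypothesis jac : forall E, measurable E -> E `<=` A ->
  nu (f @` E) = (\int[nu]_(x in E) (J x)%:E)%E.
Local Open Scope ereal_scope.

Let image_subE E : E `<=` A -> f @` E = S @^-1` E `&` f @` A.
Proof.
move=> EA; apply/seteqP; split => [_ [x Ex <-]|_ [/[swap] [[x Ax <-]]]].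
  by split; [rewrite /= fK ?inE//; exact: EA|exists x => //; exact: EA].
by rewrite /= fK ?inE// => Ex; exists x.
Qed.

(** Where J is negative its integral is the measure of an image, hence is
nonnegative; so J = 0 almost everywhere there, and that set is null. *)
Lemma jacobian_ge0_ae : ae_eq nu A (EFin \o J) (fun x => `|J x|%:E).
Proof.
pose N := A `&` [set x | (J x < 0)%R].
have mN : measurable N.
  rewrite /N (_ : [set x | _] = J @^-1` `]-oo, 0%R[%classic); first exact: mJ.
  by apply/seteqP; split => x /=; rewrite in_itv.
have mJN : measurable_fun N J by apply: measurable_funS mJ => // x [].
have NA : N `<=` A by move=> x [].
have : \int[nu]_(x in N) `|(J x)%:E| = 0.
  have N0 x : N x -> 0 <= - (J x)%:E.
    by move=> [_ Jx]; rewrite oppe_ge0 lee_fin; exact: ltW.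
  rewrite (eq_integral (fun x => - (J x)%:E)); last first.
    by move=> x /[!inE] /N0; rewrite oppe_ge0; exact: lee0_abs.
  have nuN : nu (f @` N) = - \int[nu]_(x in N) - (J x)%:E.
    rewrite jac// -(integral_ge0N _ N0); apply: eq_integral => x _.
    by rewrite oppeK.
  apply/eqP; rewrite eq_le integral_ge0// andbT.
  by rewrite -oppe_ge0 -nuN.
move/(ae_eq_integral_abs _ mN) => /(_ (measurableT_comp _ mJN)) [//|Z [mZ Z0 NZ]].
exists Z; split => // x /= /not_implyP[Ax Jx]; apply: NZ => /=.
have Nx : N x.
  split => //=; rewrite ltNge; apply: contra_notN Jx => Jx.
  by rewrite ger0_norm.
by move=> /(_ Nx)[] /eqP; rewrite (negbTE (J_neq0 Ax)).
Qed.

(** The image under S of nu on f(A) has density |J| with respect to nu on A: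
for E inside A, the points of f(A) that S sends into E are those of f(E). *)
Lemma ge0_integral_branch (h : X -> \bar R) :
  measurable_fun A h -> (forall x, A x -> 0 <= h x) ->
  \int[nu]_(z in f @` A) (h (S z) * (`|J (S z)|^-1)%:E) = \int[nu]_(x in A) h x.
Proof.
move=> mh h0.
pose g x := h x * (`|J x|^-1)%:E.
have g0 x : A x -> 0 <= g x by move=> Ax; rewrite mule_ge0 ?h0 ?lee_fin.
have mg : measurable_fun A g.
  by apply: emeasurable_funM => //; exact/measurable_EFinP/measurable_fun_normV.
transitivity (\int[pushforward (mrestr nu mfA) S]_(x in A) g x).
  rewrite [RHS]ge0_integral_pushforward//; last by move=> x /[!inE]; exact: g0.
  pose D := S @^-1` A.
  have mD : measurable D by rewrite -[D]setTI; exact: mS.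
  have fAD : f @` A `<=` D by move=> _ [x Ax <-]; rewrite /D/= fK ?inE.
  have mN : measurable (D `\` f @` A) by exact: measurableD.
  rewrite [RHS](ge0_negligible_integral mN)//; last 3 first.
  - by apply: (measurable_comp mA _ mg) => //; [move=> _ [x Dx <-]|exact: measurable_funTS].
  - by move=> x; exact: g0.
  - by rewrite /= /mrestr setDKI measure0.
  rewrite setDD setIidr//; apply: eq_measure_integral => E mE EA.
  by rewrite /= /mrestr setIidl.
(* The proof that S is measurable is an argument of this measure structure. *)
pose m1 : {measure set X -> \bar R} :=
  measure_function_pushforward__canonical__measure_function_Measure
    (mrestr nu mfA) mS.
rewrite (@ge0_integral_density _ _ _ m1 nu A (fun x => `|J x|%R))//.
- apply: eq_integral => x /[!inE] Ax; rewrite /g -muleA -EFinM mulVf ?mule1//.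
  by rewrite normr_eq0 J_neq0.
- exact: measurableT_comp.
- move=> E mE EA.
  rewrite /= /pushforward /mrestr -image_subE// jac//.
  apply: ae_eq_integral => //; first exact/measurable_EFinP/(measurable_funS _ EA).
  - exact/measurable_EFinP/measurableT_comp/(measurable_funS _ EA).
  - exact: (ae_eq_subset EA jacobian_ge0_ae).
Qed.
End branch.

(** * Piecewise invertible maps *)

Section piecewise_invertible.
Context d (X : measurableType d) (R : realType).
Variables (nu : {measure set X -> \bar R}) (F : X -> X).
Variables (A : (set X)^nat) (S : nat -> X -> X) (J : X -> R).
Hypotheses (mA : forall k, measurable (A k)) (tA : trivIset setT A).
Hypotheses (mF : forall k, measurable_fun (A k) F).
Hypotheses (mFA : forall k, measurable (F @` A k)).
Hypotheses (mS : forall k, measurable_fun setT (S k)).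
Hypotheses (FK : forall k, {in A k, cancel F (S k)}).
Hypotheses (mJ : forall k, measurable_fun (A k) J).
Hypotheses (J_neq0 : forall k x, A k x -> J x != 0).
Hypothesis jac : forall k E, measurable E -> E `<=` A k ->
  nu (F @` E) = (\int[nu]_(x in E) (J x)%:E)%E.
Local Open Scope ereal_scope.
Local Notation D := (\bigcup_k A k).

(** The Perron-Frobenius operator of the restriction of F to the union of its
domains of injectivity. *)
Definition fibre_sum (h : X -> \bar R) z : \bar R :=
  \esum_(w in D `&` F @^-1` [set z]) (h w * (`|J w|^-1)%:E).

Variable h : X -> \bar R.
Hypotheses (mh : measurable_fun D h) (h0 : forall x, 0 <= h x).

Let a w := h w * (`|J w|^-1)%:E.
Let a0 w : 0 <= a w. Proof. by rewrite mule_ge0 ?lee_fin. Qed.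
Let b k := (a \o S k) \_ (F @` A k).

(** A fibre of F has at most one point in each A k, and it has one exactly over
the image of A k. *)
Lemma fibre_sumE z : fibre_sum h z = \sum_(0 <= k <oo) b k z.
Proof.
rewrite /fibre_sum setI_bigcupl nneseries_sum_bigcup//; last first.
  by apply: trivIset_setIr.
apply: eq_eseriesr => k _; rewrite /b patchE.
case: ifPn => [|/negP zF]; last first.
  rewrite (_ : _ `&` _ = set0) ?esum_set0//.
  by apply/seteqP; split => // w [Aw Fw]; apply: zF; rewrite inE; exists w.
rewrite inE => -[w Aw Fwz]; rewrite (_ : _ `&` _ = [set w]); last first.
  apply/seteqP; split => [x [Ax /= Fxz]|_ ->]; last by split.
  by rewrite -(FK (mem_set Ax)) Fxz -Fwz FK ?inE.
rewrite esum_set1; last exact: a0.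
by rewrite /= -Fwz FK ?inE.
Qed.

Let mb k : measurable_fun setT (b k).
Proof.
apply/(measurable_restrictT _ (mFA k)).
apply: (@measurable_comp _ _ _ _ _ _ (A k) a) => //; last exact: measurable_funTS.
  by move=> _ [_ [w Aw <-] <-]; rewrite FK ?inE.
apply: emeasurable_funM.
  by apply: measurable_funS mh => //; [exact: bigcupT_measurable|exact: bigcup_sup].
exact/measurable_EFinP/measurable_fun_normV.
Qed.

Lemma measurable_fibre_sum : measurable_fun setT (fibre_sum h).
Proof.
apply: (eq_measurable_fun (fun z => \sum_(0 <= k <oo) b k z)).
  by move=> z _; rewrite fibre_sumE.
apply: ge0_emeasurable_sum => [k z _ _|k _]; last exact: mb.
by apply: erestrict_ge0 => y _; exact: a0.
Qed.

(** Duality of the transfer operator with composition by F, branch by branch. *)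
Lemma integral_fibre_sum E : measurable E ->
  \int[nu]_(z in E) fibre_sum h z = \int[nu]_(w in D `&` F @^-1` E) h w.
Proof.
move=> mE; under eq_integral do rewrite fibre_sumE.
rewrite integral_nneseries//; last 2 first.
- by move=> k; exact: measurable_funTS.
- by move=> k z _; apply: erestrict_ge0 => y _; exact: a0.
have mAE k : measurable (A k `&` F @^-1` E) by exact: mF.
rewrite setI_bigcupl ge0_integral_bigcup//; last 2 first.
- apply: measurable_funS mh; first exact: bigcupT_measurable.
  by move=> x [k _ [Ax _]]; exists k.
- by apply: trivIset_setIr.
apply: eq_eseriesr => k _; rewrite -integral_mkcondr.
have FAE : F @` (A k `&` F @^-1` E) = E `&` F @` A k.
  apply/seteqP; split => [_ [w [Aw Ew] <-]|_ [/[swap] [[w Aw <-] Ew]]].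
    by split => //; exists w.
  by exists w.
rewrite -FAE (@ge0_integral_branch _ _ _ nu _ F (S k) J)//.
- by rewrite FAE; exact: measurableI.
- by move=> w /[!inE] -[Aw _]; rewrite FK ?inE.
- by apply: (measurable_funS (mA k) _ (mJ (k:=k))) => x [].
- by move=> x [/J_neq0].
- by move=> B mB BA; apply: (jac (k := k)) => // x /BA[].
- apply: measurable_funS mh; first exact: bigcupT_measurable.
  by move=> x [Ax _]; exists k.
Qed.

End piecewise_invertible.

(** * The two branches of the map and their inverses *)

(** A section of a strictly increasing function is nondecreasing, so the
preimage of a ray is an interval. *)
Lemma measurable_monotone_section (R : realType) (A B : set R) (f g : R -> R) :
  is_interval B -> {homo g : y / B y >-> A y} -> {in B, cancel g f} ->
  (forall x y, A x -> A y -> x < y -> f x < f y) ->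
  measurable_fun B g.
Proof.
move=> iB gA gK f_incr.
have g_nd u v : B u -> B v -> u <= v -> g u <= g v.
  move=> Bu Bv uv; rewrite leNgt; apply/negP => vu.
  have := f_incr _ _ (gA _ Bv) (gA _ Bu) vu.
  by rewrite !gK ?inE// ltNge uv.
move=> mB; apply: (measurability (@RGenCInfty.G R)) => [|/= _ [_] [r] -> <-|//].
  exact: RGenCInfty.measurableE.
apply: is_interval_measurable => s t /=.
rewrite !in_itv/= !andbT => -[Bs rs] [Bt _] u /andP[su ut].
have Bu : B u by apply: (iB _ _ Bs Bt); rewrite su.
by rewrite in_itv/= andbT; split => //; exact/(le_trans rs)/g_nd.
Qed.

Section increasing_branches.
Context (R : realType) (alpha : R) (T : pm_map alpha).
Local Notation x0 := (pm_x0 T).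
Implicit Types x y : R.

Let derivable_left x : x \in `]0, x0[ -> derivable T x 1.
Proof.
rewrite in_itv/= => /andP[x_gt0 xx0].
have [] // := @pm_C2_left _ _ T (x / 2) _ x; first by rewrite divr_gt0.
by rewrite /= in_itv/= xx0 andbT ltr_pdivrMr// ltr_pMr// ltr1n.
Qed.

Let derivable_right x : x \in `]x0, 1[ -> derivable T x 1.
Proof. by move=> xx0; have [] := pm_C2_right xx0. Qed.

Lemma pm_incr_left : {in `]0, x0[ &, {homo T : x y / x < y}}.
Proof.
apply: gtr0_derive1_lt_oo => [x xI|x xI|x /[!inE] xI]; first exact: derivable_left.
  exact: lt_trans ltr01 (pm_expand_left xI).
by apply: differentiable_continuous; exact/derivable1_diffP/derivable_left.
Qed.

Lemma pm_incr_right : {in `]x0, 1[ &, {homo T : x y / x < y}}.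
Proof.
apply: gtr0_derive1_lt_oo => [x xI|x xI|x /[!inE] xI]; first exact: derivable_right.
  exact: lt_trans ltr01 (pm_expand_right xI).
by apply: differentiable_continuous; exact/derivable1_diffP/derivable_right.
Qed.

End increasing_branches.

Section inverse_branch.
Context (R : realType) (A : set R) (f : R -> R).
Hypothesis (fbij : set_bij A `]0, 1[ f).
Hypothesis (f_incr : forall x y, A x -> A y -> x < y -> f x < f y).

(** Extended by 0 outside ]0, 1[, so as to be measurable on the whole line. *)
Definition branch_inverse : R -> R := 'pinv_(fun=> 0) A f \_ `]0, 1[%classic.
Local Notation g := branch_inverse.

Lemma branch_inverseP y : y \in `]0, 1[ -> A (g y) /\ f (g y) = y.
Proof.
move=> yI; have [_ _ fsurj] := fbij; have [gA _ _] := bijpinv_bij (fun=> 0) fbij.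
rewrite /g patchE mem_set//; split; first exact: gA.
by apply: surjpK fsurj _ _; rewrite inE.
Qed.

Lemma branch_inverseK x : A x -> g (f x) = x.
Proof.
move=> Ax; have [fA finj _] := fbij.
by rewrite /g patchE mem_set; [rewrite pinvKV// inE|exact: fA].
Qed.

Lemma measurable_branch_inverse : measurable_fun setT
  (g : measurableTypeR R -> measurableTypeR R).
Proof.
have mI : measurable (`]0, 1[%classic : set (measurableTypeR R)) by [].
apply/(measurable_restrictT _ mI).
apply: (eq_measurable_fun g).
  by move=> y yI; rewrite /g patchE yI.
apply: (measurable_monotone_section (A := A) (f := f)) => //.
- exact: interval_is_interval.
- by move=> y yI; have [] := branch_inverseP yI.
- by move=> y /[!inE] yI; have [] := branch_inverseP yI.
Qed.

End inverse_branch.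

(** * The inverse branches of the return map *)

Section return_branches.
Context (R : realType) (alpha : R) (T : pm_map alpha).
Local Notation x0 := (pm_x0 T).
Implicit Types (x y : R) (i j k l : nat).

Definition left_inverse : R -> R := branch_inverse `]0, x0[%classic T.
Definition right_inverse : R -> R := branch_inverse `]x0, 1[%classic T.

(** A return of time i goes once through the right branch, then i - 1 times
through the left one. *)
Definition return_inverse i y := right_inverse (iter i.-1 left_inverse y).

(** The points of the base that are an endpoint, or whose orbit hits x0 before
it returns: x0 lies in neither branch, and the value of T there is arbitrary. *)
Definition exceptional : set R :=
  [set x0; 1] `|` (range (fun i => return_inverse i x0)).

Let x00 := pm_x0_gt0 T.
Let x01 := pm_x0_lt1 T.

Let left_sub x : x \in `]0, x0[ -> x \in `]0, 1[.
Proof. by rewrite !in_itv/= => /andP[-> /lt_trans->]. Qed.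

Let right_sub x : x \in `]x0, 1[ -> x \in `]0, 1[.
Proof. by rewrite !in_itv/= => /andP[/(lt_trans x00)-> ->]. Qed.

Let left_right x : x \in `]0, x0[ -> x \notin `]x0, 1[.
Proof. by rewrite !in_itv/= => /andP[_ xl]; rewrite negb_and -leNgt (ltW xl). Qed.

Let leftP y : y \in `]0, 1[ ->
  (left_inverse y \in `]0, x0[) /\ T (left_inverse y) = y.
Proof. exact: (branch_inverseP (pm_bij_left T)). Qed.

Let rightP y : y \in `]0, 1[ ->
  (right_inverse y \in `]x0, 1[) /\ T (right_inverse y) = y.
Proof. exact: (branch_inverseP (pm_bij_right T)). Qed.

Lemma measurable_return_inverse i : measurable_fun setT
  (return_inverse i : measurableTypeR R -> measurableTypeR R).
Proof.
have mL := measurable_branch_inverse (pm_bij_left T) (@pm_incr_left _ _ T).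
have mR := measurable_branch_inverse (pm_bij_right T) (@pm_incr_right _ _ T).
apply: (measurableT_comp mR); elim: i.-1 => [|k IH]; first exact: measurable_id.
exact: (measurableT_comp mL).
Qed.

Lemma countable_exceptional : countable exceptional.
Proof.
rewrite /exceptional -bigcup2E; apply: bigcup_countable => [|[|[|k]] _ /=].
- exact: countableP.
- exact: finite_set_countable.
- exact: sub_countable (card_image_le _ _) _.
- exact: countable0.
Qed.

Lemma base_cellP i x : (0 < i)%N -> base_cell T i x <->
  [/\ x \in `[x0, 1], iter i T x \in `]x0, 1[
    & forall j, (0 < j < i)%N -> ~~ (iter j T x \in `]x0, 1[)].
Proof.
move=> i0; rewrite /base_cell /= /return_time.
have := least_spec [set k | (0 < k)%N /\ iter k T x \in `]x0, 1[].
case: least => [k /= [[k0 kx] kmin]|none]; last first.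
  split=> [[_ i0']|[_ xi _]]; first by rewrite -i0' in i0.
  by exfalso; apply: (none i).
split=> [[xB <-]|[xB xi ximin]].
  split => // j /andP[j0 jk]; apply/negP => xj.
  by have := kmin j (conj j0 xj); rewrite leqNgt jk.
split => //; apply/eqP; rewrite eqn_leq kmin// leqNgt.
by apply/negP => ki; have := ximin k; rewrite k0 ki kx => /(_ isT).
Qed.

Let iter_left j y : y \in `]0, 1[ -> iter j left_inverse y \in `]0, 1[.
Proof. by move=> yI; elim: j => //= j /leftP[/left_sub]. Qed.

Let iter_leftS j y : y \in `]0, 1[ -> iter j.+1 left_inverse y \in `]0, x0[.
Proof. by move=> yI; have [] := leftP (iter_left j yI). Qed.

Let iter_leftK j k y : y \in `]0, 1[ ->
  iter j T (iter (j + k) left_inverse y) = iter k left_inverse y.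
Proof.
move=> yI; elim: j => //= j IH; rewrite -iterS iterSr.
by have [_ ->] := leftP (iter_left (j + k) yI).
Qed.

(** The values of L lie in the left interval, so the orbit of [return_inverse i y]
stays away from ]x0, 1[ until it reaches y at time i. *)
Lemma return_inverseP i y : (0 < i)%N -> y \in `]x0, 1[ ->
  base_cell T i (return_inverse i y) /\ iter i T (return_inverse i y) = y.
Proof.
case: i => // i _ yI; have yI01 := right_sub yI.
have [rI rK] := rightP (iter_left i yI01).
have iterE j : (j <= i)%N ->
    iter j.+1 T (return_inverse i.+1 y) = iter (i - j) left_inverse y.
  by move=> ji; rewrite iterSr /return_inverse rK -{1}(subnKC ji) iter_leftK.
have iK : iter i.+1 T (return_inverse i.+1 y) = y by rewrite iterE// subnn.
split => //; apply/base_cellP => //; split; last first.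
- move=> [//|j] /andP[_]; rewrite ltnS => ji; rewrite iterE//; last exact: ltnW.
  by rewrite -(subnSK ji); exact/left_right/iter_leftS.
- by rewrite iK.
- by move: rI; rewrite !in_itv/= => /andP[/ltW-> /ltW->].
Qed.

(** Strictly between times 0 and i the orbit of x stays in ]0, x0[: it never leaves ]0, 1[, it has
not returned to ]x0, 1[, and it would hit x0 only if x were exceptional.  Hence
each step can be undone by L, and the first one by the right inverse. *)
Lemma return_inverseK i x : (0 < i)%N -> base_cell T i x -> ~ exceptional x ->
  return_inverse i (iter i T x) = x.
Proof.
move=> i0 /base_cellP[//|xB xi ximin] xE.
have xI : x \in `]x0, 1[.
  move: xB; rewrite !in_itv/= !le_eqVlt => /andP[/predU1P[x0x|->]].
    by exfalso; apply: xE; left; left.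
  by move=> /predU1P[x1|//]; exfalso; apply: xE; left; right.
suff H j : (j < i)%N -> (iter j.+1 T x \in `]0, 1[) /\
    return_inverse j.+1 (iter j.+1 T x) = x.
  by case: i i0 H {xi ximin} => // i _ /(_ i (leqnn _))[].
elim: j => [_|j IH ji].
  have [TI _ _] := pm_bij_right T; split; first exact: TI.
  by rewrite /return_inverse /= /right_inverse (branch_inverseK (pm_bij_right T)).
have [xjI xjK] := IH (ltnW ji).
have xjl : iter j.+1 T x \in `]0, x0[.
  have := ximin j.+1; rewrite ji => /(_ isT).
  move: xjI; rewrite !in_itv/= => /andP[-> ->] /=; rewrite andbT -leNgt le_eqVlt.
  move=> /predU1P[xjx0|//]; exfalso; apply: xE; right.
  by exists j.+1 => //; rewrite -{1}xjx0.
have [TI _ _] := pm_bij_left T; split; first exact: TI.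
rewrite -[RHS]xjK.
change (right_inverse (iter j.+1 left_inverse (iter j.+2 T x)) =
  right_inverse (iter j left_inverse (iter j.+1 T x))).
rewrite iterSr; congr (right_inverse (iter _ _ _)).
exact: (branch_inverseK (pm_bij_left T)).
Qed.

End return_branches.

(** * Cells of the tower *)

Section tower_cells.
Context (R : realType) (alpha : R) (T : pm_map alpha).
Local Notation x0 := (pm_x0 T).
Local Notation F := (tower_map T).
Local Notation nu := (tower_measure T).
Implicit Types (x y : R) (z w : tower_space R) (i j k l : nat).

Lemma measurable_base_cell i : (0 < i)%N ->
  measurable (base_cell T i : set (measurableTypeR R)).
Proof.
case: i => // i _.
rewrite (_ : base_cell T i.+1 =
    ysection (tower T) i `\` ysection (tower T) i.+1).
  by apply: measurableD; apply: measurable_ysection; exact: measurable_tower.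
apply/seteqP; split => x; rewrite /ysection /= !inE /tower /=.
  by move=> [xB ->]; rewrite ltnn; split => // -[].
move=> [[xB ix] xi]; split => //; apply/eqP; rewrite eqn_leq ix andbT leqNgt.
by apply/negP => /(conj xB).
Qed.

Lemma cell_tower l i : cell T l i `<=` tower T.
Proof. by move=> z [[zB zi] [zl li]]; split; rewrite ?zl ?zi. Qed.

Lemma cell_eq l i z : cell T l i z -> z.2 = l /\ return_time T z.1 = i.
Proof. by move=> [[_ zi] [zl _]]. Qed.

Lemma tower_cell z : tower T z -> cell T z.2 (return_time T z.1) z.
Proof. by move=> [zB zl]. Qed.

Lemma cellE l i :
  cell T l i = if (l < i)%N then base_cell T i `*` [set l] else set0.
Proof.
case: ifPn => [li|/negP li]; apply/seteqP; split => //=.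
- by move=> z [zB [zl _]].
- by move=> z [zB zl].
- by move=> z [_ []].
Qed.

Lemma measurable_cell l i : measurable (cell T l i).
Proof.
rewrite cellE; case: ifP => // li; apply: measurableX => //.
by apply: measurable_base_cell; exact: leq_ltn_trans li.
Qed.

Lemma tower_map_cell l i z : cell T l i z ->
  F z = if (l.+1 < i)%N then (z.1, l.+1) else (iter i T z.1, 0%N).
Proof. by move=> [[zB zi] [zl li]]; rewrite /tower_map /base_return zi zl. Qed.

Lemma measurable_tower_map_cell l i : measurable_fun (cell T l i) F.
Proof.
have mB : measurable (`[x0, 1]%classic : set (measurableTypeR R)) by [].
have mg : measurable_fun setT
    (fun z => (((iter i T : R -> R) \_ `[x0, 1]%classic) z.1, 0%N)
      : tower_space R).
  apply: measurable_fun_pair => //; apply: measurableT_comp => //.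
  by apply/(measurable_restrictT _ mB); exact: measurable_iter_pm.
have [li|li] := boolP (l.+1 < i)%N.
  apply: (eq_measurable_fun (fun z => (z.1, l.+1) : tower_space R)).
    by move=> z /[!inE] zc; rewrite (tower_map_cell zc) li.
  by apply: measurable_funTS; exact: measurable_fun_pair.
apply: eq_measurable_fun (measurable_funTS mg) => z /[!inE] zc.
rewrite (tower_map_cell zc) (negbTE li) patchE; case: zc => -[zB _] _.
by rewrite (mem_set (zB : `[x0, 1]%classic z.1)).
Qed.

Lemma measurable_tower_preimage E : measurable E ->
  measurable (tower_preimage T E).
Proof.
move=> mE.
have -> : tower_preimage T E =
    \bigcup_l \bigcup_i (cell T l i `&` F @^-1` E).
  apply/seteqP; split => [z [/tower_cell zc Fz]|z [l _ [i _ [zc Fz]]]].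
    by exists z.2 => //; exists (return_time T z.1).
  by split => //; exact: cell_tower zc.
apply: bigcupT_measurable => l; apply: bigcupT_measurable => i.
by apply: measurable_tower_map_cell => //; exact: measurable_cell.
Qed.

(** Forward orbits are included because the fibre over a point z is to contain no
exceptional point, which is a condition on the images of exceptional points. *)
Definition exceptional_orbits : set R :=
  \bigcup_m (iter m T @` exceptional T).

Lemma countable_exceptional_orbits : countable exceptional_orbits.
Proof.
apply: bigcup_countable => [|m _]; first exact: countableP.
exact: sub_countable (card_image_le _ _) (countable_exceptional T).
Qed.

Lemma exceptional_orbits_map z : exceptional T z.1 -> exceptional_orbits (F z).1.
Proof.
move=> zE; rewrite /tower_map; case: ifP => _ /=.
  by exists 0%N => //; exists z.1.
by exists (return_time T z.1) => //; exists z.1.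
Qed.

Lemma measurable_countable_fst (D : set R) : countable D ->
  measurable (fst @^-1` D : set (tower_space R)).
Proof.
move=> cD; rewrite -[_ @^-1` _]setTI; apply: measurable_fst => //.
exact: countable_measurable.
Qed.

(** The product measure of D x nat is 0 times infinity, which is 0. *)
Lemma tower_measure_countable_fst (D : set R) : countable D ->
  nu (fst @^-1` D) = 0%E.
Proof.
move=> cD; have mD : measurable (D : set (measurableTypeR R)).
  exact: countable_measurable.
apply: (@subset_measure0 _ _ _ (lebesgue_measure \x @counting nat R)%E _ (D `*` setT)).
- apply: measurableI; last exact: measurable_tower.
  exact: measurable_countable_fst.
- exact: measurableX.
- by move=> z [].
- have D0 := countable_lebesgue_measure0 cD.
  apply: etrans (product_measure1E lebesgue_measure (@counting nat R) mD _) _ => //.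
  by rewrite [X in (X * _)%E]D0 mul0e.
Qed.

End tower_cells.

(** * The transfer operator of the tower *)

Section tower_transfer.
Context (R : realType) (alpha : R) (T : pm_map alpha).
Local Notation x0 := (pm_x0 T).
Local Notation F := (tower_map T).
Local Notation nu := (tower_measure T).
Implicit Types (x y : R) (z w : tower_space R) (i j k l : nat).

Definition good_cell l i : set (tower_space R) :=
  cell T l i `\` fst @^-1` exceptional T.

Definition cell_inverse l i z : tower_space R :=
  ((if (l.+1 < i)%N then z.1 else return_inverse T i z.1), l).

Lemma measurable_good_cell l i : measurable (good_cell l i).
Proof.
apply: measurableD; first exact: measurable_cell.
apply: measurable_countable_fst; exact: countable_exceptional.
Qed.

Lemma measurable_cell_inverse l i : measurable_fun setT (cell_inverse l i).
Proof.
apply: measurable_fun_pair => //; case: (l.+1 < i)%N; first exact: measurable_fst.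
by apply: measurableT_comp => //; exact: measurable_return_inverse.
Qed.

Lemma cell_inverseK l i : {in good_cell l i, cancel F (cell_inverse l i)}.
Proof.
move=> [x m] /[!inE] -[zc zE]; rewrite (tower_map_cell zc).
have [/= -> _] := cell_eq zc; case: zc => xB [_ li].
rewrite /cell_inverse; case: (l.+1 < i)%N => //=.
by rewrite return_inverseK//; exact: leq_ltn_trans li.
Qed.

(** Expresses the image through the measurable map [cell_inverse], as the image of
a measurable set need not be measurable in general. *)
Lemma image_good_cell l i : F @` good_cell l i =
  cell_inverse l i @^-1` good_cell l i `&`
    (if (l.+1 < i)%N then setT `*` [set l.+1] else `]x0, 1[%classic `*` [set 0%N]).
Proof.
apply/seteqP; split => [_ [z zg <-]|z [zg zI]].
  split; first by rewrite /= cell_inverseK ?inE.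
  case: zg => zc _; rewrite (tower_map_cell zc).
  case: ifP => // _; split => //=; case: zc => zB [_ li].
  by case/base_cellP : zB => //; exact: leq_ltn_trans li.
exists (cell_inverse l i z) => //; rewrite (tower_map_cell zg.1).
have i0 : (0 < i)%N by case: zg => -[_ [_ li]] _; exact: leq_ltn_trans li.
move: zI; rewrite /cell_inverse; case: ifP => _ [zI zl] /=.
  by rewrite [RHS]surjective_pairing zl.
by have [_ ->] := return_inverseP i0 zI; rewrite [RHS]surjective_pairing zl.
Qed.

Lemma measurable_image_good_cell l i : measurable (F @` good_cell l i).
Proof.
rewrite image_good_cell; apply: measurableI.
  rewrite -[_ @^-1` _]setTI; apply: measurable_cell_inverse => //.
  exact: measurable_good_cell.
by case: ifP => _; exact: measurableX.
Qed.

(* pickle_inv is injective where it is defined; the default (0, 0) names an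
   empty cell, so the indexed cells are disjoint. *)
Let index k : nat * nat := odflt (0, 0)%N (pickle_inv k).
Let G k := good_cell (index k).1 (index k).2.

Let bigcup_good : \bigcup_k G k = tower T `\` fst @^-1` exceptional T.
Proof.
apply/seteqP; split => [z [k _ [zc zE]]|z [zt zE]].
  by split => //; exact: cell_tower zc.
exists (pickle (z.2, return_time T z.1)) => //; rewrite /G /index pickleK_inv /=.
by split => //; exact: tower_cell.
Qed.

Let trivIset_good : trivIset setT G.
Proof.
move=> j k _ _ [z [[zj _] [zk _]]].
have [zl zi] := cell_eq zj; have [zl' zi'] := cell_eq zk.
have ejk : index j = index k.
  by rewrite [LHS]surjective_pairing [RHS]surjective_pairing -zl -zi -zl' -zi'.
have i0 : (0 < (index j).2)%N by case: zj => _ [_]; exact: leq_ltn_trans.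
move: i0 ejk; rewrite /index.
have := @pickle_invK (nat * nat)%type k; have := @pickle_invK (nat * nat)%type j.
case: (pickle_inv j) => [u|//]; case: (pickle_inv k) => [v|] /=.
  by move=> <- <- _ ->.
by move=> _ _ + u0; rewrite u0.
Qed.

Variable JF : tower_space R -> R.
Hypothesis jacF : tower_jacobian T JF.

(** K sums over the good cells only: it agrees with the sum over the whole fibre
of z unless the point z.1 lies on the forward orbit of an exceptional point. *)
Lemma transfer_change_of_variables (h : tower_space R -> \bar R) :
  measurable_fun setT h -> (forall w, (0 <= h w)%E) ->
  exists K : tower_space R -> \bar R,
  [/\ measurable_fun setT K, forall z, (0 <= K z)%E,
      {ae nu, forall z, (\esum_(w in tower_preimage T [set z])
        (h w * (`|JF w|^-1)%:E) = K z)%E}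
    & forall E, measurable E ->
        (\int[nu]_(z in E) K z = \int[nu]_(w in tower_preimage T E) h w)%E].
Proof.
move=> mh h0; have [mJ J_neq0 jac] := jacF.
pose S k := cell_inverse (index k).1 (index k).2.
have mG k : measurable (G k) by exact: measurable_good_cell.
have Gt k : G k `<=` tower T by move=> z [/cell_tower].
have mhG : measurable_fun (\bigcup_k G k) h by exact: measurable_funTS.
have mF k : measurable_fun (G k) F.
  apply: (@measurable_funS _ _ _ _ (cell T (index k).1 (index k).2)).
  - exact: measurable_cell.
  - exact: subDsetl.
  - exact: measurable_tower_map_cell.
have mFG k : measurable (F @` G k) by exact: measurable_image_good_cell.
have mS k : measurable_fun setT (S k) by exact: measurable_cell_inverse.
have FK k : {in G k, cancel F (S k)} by exact: cell_inverseK.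
have mJG k : measurable_fun (G k) JF.
  exact: measurable_funS (measurable_tower T) (Gt k) mJ.
have JG k z : G k z -> JF z != 0 by move=> /Gt; exact: J_neq0.
have jacG k E : measurable E -> E `<=` G k ->
    nu (F @` E) = (\int[nu]_(x in E) (JF x)%:E)%E.
  move=> mE EG; have [ki|ki] := ltnP (index k).1 (index k).2.
    by apply: jac ki mE _ => z /EG[].
  have -> : E = set0.
    by apply/seteqP; split => // z /EG[[_ [_]]]; rewrite ltnNge ki.
  by rewrite image_set0 measure0 integral_set0.
exists (fibre_sum F G JF h); split.
- exact: (measurable_fibre_sum mG trivIset_good mFG mS FK mJG).
- by move=> z; apply: esum_ge0 => w _; rewrite mule_ge0 ?lee_fin.
- exists (fst @^-1` exceptional_orbits T); split.
  + apply: measurable_countable_fst; exact: countable_exceptional_orbits.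
  + apply: tower_measure_countable_fst; exact: countable_exceptional_orbits.
  + move=> z /=; apply: contra_notP => zE.
    rewrite /fibre_sum bigcup_good; congr (esum _ _).
    apply/seteqP; split => [w [wt Fwz]|w [[wt _] Fwz]]; last by split.
    split => //; split => // /exceptional_orbits_map; by rewrite Fwz.
- move=> E mE.
  rewrite (integral_fibre_sum (J := JF) mG trivIset_good mF mFG mS FK)//.
  rewrite bigcup_good.
  pose N : set (tower_space R) := fst @^-1` exceptional T.
  rewrite [RHS](@ge0_negligible_integral _ _ _ _ _ N)//.
  + by rewrite /tower_preimage setIDAC setIDA.
  + apply: measurable_countable_fst; exact: countable_exceptional.
  + exact: measurable_tower_preimage.
  + exact: measurable_funTS.
  + apply: tower_measure_countable_fst; exact: countable_exceptional.
Qed.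

End tower_transfer.

Section duality.
Context (R : realType) (alpha : R) (T : pm_map alpha).
Variable JF : tower_space R -> R.
Hypothesis jacF : tower_jacobian T JF.
Local Notation nu := (tower_measure T).
Local Open Scope ereal_scope.

(** The transfer of psi is the difference of the fibre sums of its positive and
negative parts; the second one integrates to the integral of psi^-, which is 0,
so it vanishes almost everywhere. *)
Lemma transfer_duality (psi : tower_space R -> R) :
  measurable_fun setT psi -> {ae nu, forall w, (0 <= psi w)%R} ->
  exists K : tower_space R -> \bar R,
  [/\ measurable_fun setT K, forall z, 0 <= K z,
      {ae nu, forall z, transfer T JF psi z = K z}
    & forall E, measurable E ->
        \int[nu]_(z in E) K z = \int[nu]_(w in tower_preimage T E) (psi w)%:E].
Proof.
move=> mpsi psi0; pose f w := (psi w / `|JF w|)%:E.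
have mf : measurable_fun setT (EFin \o psi) by exact/measurable_EFinP.
have J0 w : 0 <= (`|JF w|^-1)%:E by rewrite lee_fin.
have fp w : f^\+ w = (EFin \o psi)^\+ w * (`|JF w|^-1)%:E.
  by rewrite !funeposE maxe_pMl// mul0e.
have fn w : f^\- w = (EFin \o psi)^\- w * (`|JF w|^-1)%:E.
  by rewrite !funenegE maxe_pMl// mul0e mulNe.
have [Kp [mKp Kp0 KpE Kpint]] :=
  transfer_change_of_variables jacF (measurable_funepos mf) (funepos_ge0 _).
have [Kn [mKn Kn0 KnE Knint]] :=
  transfer_change_of_variables jacF (measurable_funeneg mf) (funeneg_ge0 _).
have pE E : measurable E ->
    \int[nu]_(w in E) (EFin \o psi)^\+ w = \int[nu]_(w in E) (psi w)%:E.
  move=> mE; apply: ae_eq_integral => //.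
  - by apply: measurable_funTS; exact: measurable_funepos.
  - exact: measurable_funTS.
  - by apply: filterS psi0 => w w0 _; rewrite funeposE /= max_l// lee_fin.
have Kn_ae0 : {ae nu, forall z, Kn z = 0}.
  have : \int[nu]_z `|Kn z| = 0.
    rewrite (eq_integral Kn); last by move=> z _; rewrite gee0_abs.
    rewrite Knint// (ae_eq_integral (cst 0)) ?integral0//.
    - exact: measurable_tower_preimage.
    - by apply: measurable_funTS; exact: measurable_funeneg.
    - by apply: filterS psi0 => w w0 _; rewrite funenegE /= max_r// lee_fin oppr_le0.
  by move/(ae_eq_integral_abs _ measurableT mKn); apply: filterS => z; exact.
exists Kp; split => //.
- apply: filterS3 KpE KnE Kn_ae0 => z <- KnzE Kn0z.
  rewrite /transfer -/f (eq_esum (fun w _ => fp w)) (eq_esum (fun w _ => fn w)).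
  by rewrite KnzE Kn0z sube0.
- by move=> E mE; rewrite Kpint// pE//; exact: measurable_tower_preimage.
Qed.

End duality.

(** * The hole *)

Section holes.
Context (R : realType) (alpha : R) (T : pm_map alpha).
Local Notation F := (tower_map T).
Implicit Types (z w : tower_space R) (i j k l n : nat).

Lemma measurable_hole n : measurable (hole T n).
Proof.
apply: bigcup_measurable => i _; apply: bigcup_measurable => l _.
exact: measurable_cell.
Qed.

Lemma measurable_hole1 n : measurable (hole1 T n).
Proof. by apply: bigcup_measurable => i _; exact: measurable_cell. Qed.

Lemma hole_tower n : hole T n `<=` tower T.
Proof. by move=> z [i _ [l _ /cell_tower]]. Qed.

Lemma hole1_tower n : hole1 T n `<=` tower T.
Proof. by move=> z [i _ /cell_tower]. Qed.

Lemma holeP n z : tower T z ->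
  hole T n z <-> (0 < z.2)%N /\ (n < return_time T z.1)%N.
Proof.
move=> zt; split=> [[i ni [l /andP[l0 _] /cell_eq[-> ->]]]//|[z0 nz]].
exists (return_time T z.1) => //; exists z.2; last exact: tower_cell.
by rewrite /= z0; case: zt.
Qed.

Lemma hole1P n z : tower T z ->
  hole1 T n z <-> z.2 = 0%N /\ (n < return_time T z.1)%N.
Proof.
move=> zt; split=> [[i ni /cell_eq[-> ->]]//|[z0 nz]].
by exists (return_time T z.1) => //; rewrite -z0; exact: tower_cell.
Qed.

(** The hole is entered only from its own columns, whose points outside the hole
lie on the base; with 0 < n the return time is at least 2, so F lifts such a
base point to level 1 of its column. *)
Lemma hole_tower_map n z : (0 < n)%N -> tower T z -> ~ hole T n z ->
  hole T n (F z) <-> hole1 T n z.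
Proof.
move=> n0 zt zH.
have FE : F z = if (z.2.+1 < return_time T z.1)%N then (z.1, z.2.+1)
    else (base_return T z.1, 0%N) by [].
rewrite hole1P//; split=> [FH|[z0 nz]].
  have := (holeP n (hole_tower FH)).1 FH; rewrite FE; case: ifPn => _ /= [// _ nz].
  split => //; apply/eqP; rewrite -leqn0 leqNgt; apply/negP => z0.
  by apply: zH; apply/holeP.
have zl : (z.2.+1 < return_time T z.1)%N by rewrite z0; exact: leq_ltn_trans nz.
by rewrite FE zl; apply/holeP => //=; case: zt.
Qed.

End holes.

(** * Conditional invariance *)

Section conditional_invariance.
Context (R : realType) (alpha : R) (T : pm_map alpha).
Variable JF : tower_space R -> R.
Hypothesis jacF : tower_jacobian T JF.
Local Notation nu := (tower_measure T).
Local Open Scope ereal_scope.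

(** Duality for phi cut off by the hole.  The positive part of phi is used to take
out the factor lam, which may be infinite. *)
Lemma conditional_invariance n (phi : tower_space R -> R) (lam : \bar R) :
  measurable_fun setT phi -> {ae nu, forall z, (0 <= phi z)%R} -> 0 <= lam ->
  {ae nu, forall z, cond_transfer T JF n phi z = lam * (phi z)%:E} ->
  forall E, measurable E -> E `<=` tower T `\` hole T n ->
  \int[nu]_(z in tower_preimage T E `\` hole T n) (phi z)%:E =
  lam * \int[nu]_(z in E) (phi z)%:E.
Proof.
move=> mphi phi0 lam0 eigen E mE ED.
set D := tower T `\` hole T n in ED *.
have mD : measurable D.
  by apply: measurableD; [exact: measurable_tower|exact: measurable_hole].
have mphiE : measurable_fun setT (EFin \o phi) by exact/measurable_EFinP.
pose psi w := (phi w * \1_D w)%R.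
have mpsi : measurable_fun setT psi by apply: measurable_funM.
have psi0 : {ae nu, forall w, (0 <= psi w)%R}.
  by apply: filterS phi0 => w w0; rewrite mulr_ge0.
have [K [mK K0 KE Kint]] := transfer_duality jacF mpsi psi0.
pose phip := (EFin \o phi)^\+.
have mphip : measurable_fun setT phip by exact: measurable_funepos.
have phipE : {ae nu, forall z, (phi z)%:E = phip z}.
  by apply: filterS phi0 => z z0; rewrite /phip funeposE /= max_l.
transitivity (\int[nu]_(z in E) K z).
  rewrite Kint// -[X in X `\` _](setIidl (_ : _ `<=` tower T)); last first.
    by move=> z [].
  rewrite -setIDA -/D integral_mkcondr; apply: eq_integral => z _.
  by rewrite epatch_indic.
transitivity (\int[nu]_(z in E) (lam * phip z)).
  apply: ae_eq_integral => //.
  - exact: measurable_funTS.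
  - by apply: measurable_funTS; exact: measurable_funeM.
  - apply: filterS3 KE phipE eigen => z KzE phizE eigenz Ez.
    rewrite -KzE -phizE -eigenz /cond_transfer -/D indicE mem_set ?mul1e//.
    exact: ED.
rewrite ge0_integralZl//.
- congr (_ * _); apply: ae_eq_integral => //; [exact: measurable_funTS..|].
  by apply: filterS phipE => z ->.
- exact: measurable_funTS.
- by move=> z _; exact: funepos_ge0.
Qed.

End conditional_invariance.

Theorem corollary4p4 (R : realType) (alpha : R)
    (alpha_gt0 : 0 < alpha) (alpha_lt1 : alpha < 1) (T : pm_map alpha)
    (nsF : nonsingular T)
    (JF : tower_space R -> R) (jacF : tower_jacobian T JF)
    (c beta : R) (beta_gt0 : 0 < beta) (beta_lt1 : beta < 1)
    (distF : distortion T JF c beta)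
    (C : R) (C_gt0 : 0 < C) (le_cC : c / (1 - beta) <= C)
    (n : nat) (n_ge1 : (1 <= n)%N)
    (phi : tower_space R -> R) (phi_cone : cone_hole T C beta n phi)
    (phi_eigen : {ae tower_measure T, forall z,
       cond_transfer T JF n phi z =
       ('N[tower_measure T]_1 [cond_transfer T JF n phi] * (phi z)%:E)%E})
    (mu : {measure set (tower_space R) -> \bar R})
    (mu_density : forall E, measurable E ->
       mu E = (\int[tower_measure T]_(z in E) (phi z)%:E)%E) :
  let lambda := 'N[tower_measure T]_1 [cond_transfer T JF n phi]%E in
  accim T (hole T n) mu lambda /\ lambda = (1 - mu (hole1 T n))%E.
Proof.
pose nu := tower_measure T; pose H := hole T n; pose D := tower T `\` H.
have mt := measurable_tower T; have mH := measurable_hole T n.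
have mH1 := measurable_hole1 T n.
have mD : measurable D by exact: measurableD.
have [[/integrableP[mphi _] phi_ge0 _] phi1 phiH] := phi_cone.
have mphiR : measurable_fun setT phi by exact/measurable_EFinP.
have mu0 E : measurable E -> nu E = 0%E -> mu E = 0%E.
  move=> mE nuE; rewrite mu_density// null_set_integral//.
  exact: measurable_funTS.
have mu_null : mu `<< nu by move=> E nuE A mA AE; apply: mu0 => //; exact: nuE.
move=> lambda.
have main E : measurable E -> E `<=` D ->
    mu (tower_preimage T E `\` H) = (lambda * mu E)%E.
  move=> mE ED; rewrite !mu_density//.
    exact: (conditional_invariance jacF mphiR phi_ge0
      (Lnorm_ge0 _ _ _) phi_eigen).
  by apply: measurableD => //; exact: measurable_tower_preimage.
have mpre E : measurable E -> measurable (tower_preimage T E).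
  exact: measurable_tower_preimage.
have muH : mu H = 0%E.
  rewrite mu_density// (ae_eq_integral (cst 0%E)) ?integral0//.
    exact: measurable_funTS.
  by apply: filterS phiH => z phiz /phiz ->.
have nuNt : nu (~` tower T) = 0%E.
  by rewrite /nu/= /tower_measure /mrestr setICl measure0.
have muNt : mu (~` tower T) = 0%E by apply: mu0 nuNt; exact: measurableC.
have muD : mu D = 1%E by rewrite mu_density.
have muT : mu setT = 1%E.
  rewrite -(setUv (tower T)) measureU0 ?muNt//; last exact: measurableC.
  rewrite -(setDUK (@hole_tower _ _ T n)) setUC measureU0//.
split; first by split.
(* A point mapped outside the tower never returns again, and F is non-singular. *)
have muN : mu (tower_preimage T (~` tower T)) = 0%E.
  apply: mu0; first by apply: mpre; exact: measurableC.
  by apply: nsF nuNt; exact: measurableC.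
(* The complement of the hole splits into the points that stay, those that enter
   the hole, and a null set of points that leave the tower. *)
have escape : D = (tower_preimage T D `\` H) `|`
    (hole1 T n `|` (tower_preimage T (~` tower T) `\` H `\` hole1 T n)).
  apply/seteqP; split => [z [zt zH]|z].
    have [z1|z1] := pselect (hole1 T n z); first by right; left.
    have [Fzt|Fzt] := pselect (tower T (tower_map T z)); last by right; right.
    left; split => //; split => //; split => //.
    by move/(hole_tower_map n_ge1 zt zH).
  have H1H w : hole1 T n w -> ~ H w.
    move=> w1; have wt := hole1_tower w1.
    by move/(hole1P _ wt): w1 => [w0 _] /(holeP _ wt)[]; rewrite w0.
  by move=> [[[]]|[/[dup] /hole1_tower zt /H1H|[[[]]]]].
have mN : measurable (tower_preimage T (~` tower T)).
  by apply: mpre; exact: measurableC.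
have mN' : measurable (tower_preimage T (~` tower T) `\` H `\` hole1 T n).
  by do 2 apply: measurableD => //.
have lam_mu : (lambda + mu (hole1 T n) = 1)%E.
  rewrite -[RHS]muD escape measureU//; last 3 first.
  - by apply: measurableD => //; exact: mpre.
  - exact: measurableU.
  - apply/seteqP; split => // z [[[zt [Fzt FzH]] zH]].
    move=> [z1|[[[_ //]]]].
    by apply: FzH; apply/(hole_tower_map n_ge1 zt zH).
  rewrite /= main// muD mule1 measureU0//.
  by apply: subset_measure0 muN => // z [[]].
rewrite -lam_mu addeK// ge0_fin_numE//.
apply: le_lt_trans (ltry 1); rewrite -lam_mu leeDr//.
exact: Lnorm_ge0.
Qed.
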